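(* Let $\mathbb{K}$ be a field of characteristic $0$. Let $(\mathfrak{g},\delta_{\mathfrak g})$ be a Lie bialgebra over $\mathbb{K}$, let $(V,\delta_V)$ be a $d$-dimensional Lie coalgebra over $\mathbb{K}$, let $V^*$ be its dual Lie algebra, and let $\mathbb{D}\colon V^*\to \mathrm{BiDer}(\mathfrak{g})$ be a Lie algebra map. Let $\{t_1,\dots,t_d\}$ be a basis of $V$, $\{t_1^*,\dots,t_d^*\}$ the dual basis of $V^*$, and $D_i=\mathbb{D}(t_i^* )$ for $1\le i\le d$. Then the map defined for all $x\in\mathfrak{g}$ and $v\in V$ by $$\delta(x+v)=\delta_{\mathfrak g}(x)+2\sum_{i=1}^d D_i(x)\wedge t_i+\delta_V(v)$$ defines a Lie bialgebra structure on the Lie algebra $\mathfrak{L}=\mathfrak{g}\times V$, where $V$ is regarded as an abelian Lie algebra.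
   Context: A Lie bialgebra over $\mathbb{K}$ is a Lie algebra $\mathfrak g$ with a linear map $\delta\colon\mathfrak g\to\Lambda^2\mathfrak g$ which satisfies co-Jacobi ($\mathrm{Alt}((\delta\otimes \mathrm{id})\circ\delta)=0$, equivalently the degree-one derivation $\partial_\delta$ of $\Lambda^\bullet\mathfrak g$ extending $\delta$ satisfies $\partial_\delta^2=0$) and is a 1-cocycle: $\delta[x,y]=\mathrm{ad}_x\delta(y)-\mathrm{ad}_y\delta(x)$. A Lie coalgebra is a vector space $V$ with a linear map $\delta_V\colon V\to\Lambda^2V$ satisfying co-Jacobi. A coderivation of $(\mathfrak g,\delta)$ is a linear map $D\colon\mathfrak g\to\mathfrak g$ with $(D\otimes\mathrm{id}+\mathrm{id}\otimes D)\circ\delta=\delta\circ D$. A biderivation of $(\mathfrak g,\delta)$ is a linear map that is both a derivation and a coderivation; $\mathrm{BiDer}(\mathfrak g)$ is the Lie algebra of biderivations under the commutator. Normalization: $\Lambda^2\subset\otimes^2$ via $x\wedge y=\tfrac12(x\otimes y-y\otimes x)$; thus if $\delta_V(t_k)=\sum_{i,j}c_k^{ij}\,t_i\wedge t_j$ with $c_k^{ij}=-c_k^{ji}$, the bracket on $V^*$ dual to $\delta_V$ is $[t_i^*,t_j^*]=\sum_k c_k^{ij}t_k^*$. *)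

(* Defs.v *)
From HB Require Import structures.
From mathcomp Require Import all_boot all_algebra.
From mathcomp Require Import ring mathcomp_extra boolp functions.
From mathcomp.multinomials Require Import freeg.

Set Implicit Arguments.
Unset Strict Implicit.
Unset Printing Implicit Defensive.

Import GRing.Theory.
Local Open Scope ring_scope.
Local Open Scope quotient_scope.

Lemma linear_ex (K : fieldType) (U V : lmodType K) (f : U -> V) :
  linear f -> {h : {linear U -> V} | f = h}.
Proof.
move=> fl; pose m := GRing.isLinear.Build K U V *:%R f fl.
pose h : {linear U -> V} := HB.pack f m.
by exists h.
Qed.

Definition bilin (K : fieldType) (U V X : lmodType K) (f : U -> V -> X) : Prop :=
  (forall v, linear (f^~ v)) /\ (forall u, linear (f u)).

(* U (x) V is the free K-module on U * V modulo the submodule spanned by the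
   bilinearity relations; no finiteness is assumed on U or V. *)
Section Tensor.
Context (K : fieldType) (U V : lmodType K).

Local Notation gen u v := (Freeg [:: (1, (u, v))] : {freeg (U * V)%type / K}).

Inductive bilin_span : {freeg (U * V)%type / K} -> Prop :=
| BSpan0 : bilin_span 0
| BSpanD r s : bilin_span r -> bilin_span s -> bilin_span (r + s)
| BSpanZ a r : bilin_span r -> bilin_span (a *: r)
| BSpanL a u u' v :
    bilin_span (gen (a *: u + u') v - (a *: gen u v + gen u' v))
| BSpanR a u v v' :
    bilin_span (gen u (a *: v + v') - (a *: gen u v + gen u v')).

Definition bilin_rel : {pred {freeg (U * V)%type / K}} :=
  fun r => `[< bilin_span r >].

Fact bilin_rel_zmod_closed : zmod_closed bilin_rel.
Proof.
split; first exact/asboolP/BSpan0.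
move=> r s /asboolP hr /asboolP hs; apply/asboolP/BSpanD => //.
by rewrite -scaleN1r; apply: BSpanZ.
Qed.

HB.instance Definition _ :=
  GRing.isZmodClosed.Build _ bilin_rel bilin_rel_zmod_closed.

Definition tensor := Quotient.quot (bilin_rel : zmodClosed _).

HB.instance Definition _ := Choice.on tensor.
HB.instance Definition _ := EqQuotient.on tensor.
HB.instance Definition _ := GRing.Zmodule.on tensor.
HB.instance Definition _ := ZmodQuotient.on tensor.

Lemma tensor_eqP (r s : {freeg (U * V)%type / K}) :
  \pi_tensor r = \pi_tensor s <-> bilin_span (r - s).
Proof.
have := Quotient.idealrBE (bilin_rel : zmodClosed _) r s => e.
split; last by move=> /asboolP h; apply/eqP; rewrite -e.
by move=> /eqP; rewrite -e => /asboolP.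
Qed.

Definition tscale (a : K) (t : tensor) : tensor := \pi_tensor (a *: repr t).

Fact tscale_pi a r : tscale a (\pi_tensor r) = \pi_tensor (a *: r).
Proof.
apply/tensor_eqP; rewrite -scalerBr; apply: BSpanZ.
by apply/tensor_eqP; rewrite reprK.
Qed.

Fact pi_tensorD r s : \pi_tensor (r + s) = \pi_tensor r + \pi_tensor s.
Proof. exact: (@Quotient.pi_add _ (bilin_rel : zmodClosed _)). Qed.

Fact tscaleA a b t : tscale a (tscale b t) = tscale (a * b) t.
Proof.
elim/quotW: t => r; rewrite (tscale_pi b) (tscale_pi a) (tscale_pi (a * b)).
by rewrite scalerA.
Qed.

Fact tscale1 t : tscale 1 t = t.
Proof. by elim/quotW: t => r; rewrite tscale_pi scale1r. Qed.

Fact tscaleDr : right_distributive tscale +%R.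
Proof.
move=> a; elim/quotW=> r; elim/quotW=> s.
by rewrite -pi_tensorD (tscale_pi a (r + s)) !tscale_pi scalerDr pi_tensorD.
Qed.

Fact tscaleDl t : {morph tscale^~ t : a b / a + b}.
Proof.
move=> a b; elim/quotW: t => r.
by rewrite (tscale_pi (a + b)) (tscale_pi a) (tscale_pi b) scalerDl pi_tensorD.
Qed.

HB.instance Definition _ := GRing.Zmodule_isLmodule.Build K tensor
  tscaleA tscale1 tscaleDr tscaleDl.

Definition tpure (u : U) (v : V) : tensor := \pi_tensor (gen u v).

Fact pi_tensorZ a r : \pi_tensor (a *: r) = a *: \pi_tensor r.
Proof. exact/esym/tscale_pi. Qed.

Lemma tpure_bilin : bilin tpure.
Proof.
split=> [v a u u'|u a v v'] /=; rewrite /tpure -pi_tensorZ -pi_tensorD.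
  exact/tensor_eqP/BSpanL.
exact/tensor_eqP/BSpanR.
Qed.

Lemma tensor_ind (P : tensor -> Prop) :
  P 0 -> (forall s t, P s -> P t -> P (s + t)) ->
  (forall u v, P (tpure u v)) -> forall t, P t.
Proof.
move=> P0 PD Pg t; rewrite -[t]reprK -[repr t]freeg_sumE.
have pi0 : \pi_tensor 0 = 0 := @pi_zeror _ _ _ _ _ tensor.
elim/big_rec: _ => [|[u v] r _ Pr]; first by rewrite pi0.
rewrite pi_tensorD; apply: PD => //.
set c := coeff _ _; have -> : \pi_tensor (<< c *g (u, v) >>) = tpure (c *: u) v.
  have -> : << c *g (u, v) >> = c *: gen u v.
    by apply/eqP/freeg_eqP => x; rewrite coeffZ !coeffU mul1r.
  have := tpure_bilin.1 v c u 0; rewrite addr0 => /= ->.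
  have := tpure_bilin.1 v (-1) u u; rewrite !scaleN1r !addNr => /= ->.
  by rewrite addr0 pi_tensorZ.
exact: Pg.
Qed.

(* Evaluates f on a representative: meaningful only for bilinear f, see tliftE
   and tlift_linear. The same caveat applies to tmap and tlift3. *)
Definition tlift (X : lmodType K) (f : U -> V -> X) (t : tensor) : X :=
  fglift (fun p => f p.1 p.2) (repr t).

End Tensor.

Arguments tpure {K U V} u v.
Arguments tlift {K U V X} f t.

Notation "x \ox y" := (tpure x y) (at level 40, left associativity) : ring_scope.

Section TensorLift.
Context (K : fieldType) (U V X : lmodType K).
Implicit Types f : U -> V -> X.

Let L f : {freeg (U * V)%type / K} -> X := fglift (fun p => f p.1 p.2).

Let LZD f a r s : L f (a *: r + s) = a *: L f r + L f s.
Proof.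
have LB x y : L f (x - y) = L f x - L f y by exact: lift_is_additive.
have L0 : L f 0 = 0 by rewrite -(subrr 0) LB subrr.
have LD x y : L f (x + y) = L f x + L f y.
  by rewrite -[y]opprK LB opprK -[- y]sub0r LB L0 sub0r opprK.
have LS (I : eqType) (q : seq I) (G : I -> _) :
  L f (\sum_(i <- q) G i) = \sum_(i <- q) L f (G i) by exact: (big_morph _ LD L0).
rewrite LD; congr (_ + _).
rewrite -{2}[r]freeg_sumE {1}/GRing.scale /= /fgscale !LS scaler_sumr.
by apply: eq_bigr => p _; rewrite /L !liftU scalerA.
Qed.

Let LB f r s : L f (r - s) = L f r - L f s.
Proof. by rewrite -(scaleN1r s) [r + _]addrC LZD scaleN1r addrC. Qed.

Let L_span f r : bilin f -> bilin_span r -> L f r = 0.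
Proof.
move=> [fl fr]; have L0 : L f 0 = 0 by rewrite -(subrr 0) LB subrr.
elim=> [//|x y _ hx _ hy|a x _ hx|a u u' v|a u v v'].
- by rewrite -[x]scale1r LZD hx hy scaler0 addr0.
- by rewrite -[a *: x]addr0 LZD L0 hx scaler0 addr0.
- by rewrite LB LZD /L !liftU /= !scale1r (fl v a u u') subrr.
- by rewrite LB LZD /L !liftU /= !scale1r (fr u a v v') subrr.
Qed.

Let tlift_pi f r : bilin f -> tlift f (\pi_(tensor U V) r) = L f r.
Proof.
move=> fb; apply/eqP; rewrite -subr_eq0 /tlift -/(L f _) -LB; apply/eqP.
by apply: L_span => //; apply/tensor_eqP; rewrite reprK.
Qed.

Lemma tliftE f u v : bilin f -> tlift f (u \ox v) = f u v.
Proof. by move=> fb; rewrite tlift_pi // /L liftU scale1r. Qed.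

Lemma tlift_linear f : bilin f -> linear (tlift f).
Proof.
move=> fb a s t; rewrite -[s]reprK -[t]reprK -pi_tensorZ -pi_tensorD.
by rewrite !tlift_pi // LZD.
Qed.

Lemma tensor_ext (h k : tensor U V -> X) : linear h -> linear k ->
  (forall u v, h (u \ox v) = k (u \ox v)) -> h =1 k.
Proof.
move=> /linear_ex[h' ->] /linear_ex[k' ->] e; elim/tensor_ind => [|s t hs ht|//].
  by rewrite !raddf0.
by rewrite !raddfD /= hs ht.
Qed.
End TensorLift.

Section TensorMaps.
Context (K : fieldType).

Definition tmap (U U' V V' : lmodType K) (f : U -> U') (h : V -> V') :
  tensor U V -> tensor U' V' := tlift (fun u v => f u \ox h v).

Definition tlift3 (U V W X : lmodType K) (f : U -> V -> W -> X) :
  tensor (tensor U V) W -> X := tlift (fun p w => tlift (fun u v => f u v w) p).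

(* Lambda^2 U is identified with a subspace of U (x) U through
   x ^ y = 1/2 (x (x) y - y (x) x). *)
Definition wedge (U : lmodType K) (x y : U) : tensor U U :=
  2^-1 *: (x \ox y - y \ox x).

Definition Lambda2 (U : lmodType K) (t : tensor U U) : Prop :=
  exists s : seq (U * U), t = \sum_(p <- s) wedge p.1 p.2.

(* The conventional factor 1/6 is omitted: Alt is only compared with 0. *)
Definition Alt3 (U : lmodType K) : tensor (tensor U U) U -> tensor (tensor U U) U :=
  tlift3 (fun x y z => x \ox y \ox z + y \ox z \ox x + z \ox x \ox y
                     - y \ox x \ox z - x \ox z \ox y - z \ox y \ox x).

Definition leib (U : lmodType K) (f : U -> U) (t : tensor U U) : tensor U U :=
  tmap f idfun t + tmap idfun f t.

Definition lie_bracket (L : lmodType K) (br : L -> L -> L) : Prop :=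
  [/\ bilin br, forall x, br x x = 0 &
      forall x y z, br x (br y z) + br y (br z x) + br z (br x y) = 0].

Definition lie_cobracket (V : lmodType K) (co : V -> tensor V V) : Prop :=
  [/\ linear co, forall x, Lambda2 (co x) &
      forall x, Alt3 (tmap co idfun (co x)) = 0].

(* ad_x acts on L (x) L as leib (br x). *)
Definition cocycle (L : lmodType K) (br : L -> L -> L) (co : L -> tensor L L) : Prop :=
  forall x y, co (br x y) = leib (br x) (co y) - leib (br y) (co x).

End TensorMaps.

Section TensorMapTheory.
Context (K : fieldType).
Implicit Types U V W X : lmodType K.

Lemma linear_id U : linear (idfun : U -> U).
Proof. by []. Qed.

Lemma linear_lc U V a (f h : U -> V) :
  linear f -> linear h -> linear (fun x => a *: f x + h x).
Proof.
by move=> fl hl b x y; rewrite fl hl !scalerDr addrACA !scalerA (mulrC a).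
Qed.

Lemma linear_comp U V W (f : V -> W) (h : U -> V) :
  linear f -> linear h -> linear (fun x => f (h x)).
Proof. by move=> fl hl a x y; rewrite hl fl. Qed.

Lemma linear_sub U V (f h : U -> V) :
  linear f -> linear h -> linear (fun x => f x - h x).
Proof.
by move=> fl hl a x y; rewrite fl hl scalerBr opprD addrACA.
Qed.

Lemma bilin_comp U U' V V' X (b : U' -> V' -> X) (f : U -> U') (h : V -> V') :
  bilin b -> linear f -> linear h -> bilin (fun u v => b (f u) (h v)).
Proof.
move=> [bl br] fl hl; split=> [v a x y|u a x y] /=; first by rewrite fl bl.
by rewrite hl br.
Qed.

Lemma tmapE U U' V V' (f : U -> U') (h : V -> V') u v :
  linear f -> linear h -> tmap f h (u \ox v) = f u \ox h v.
Proof.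
by move=> fl hl; rewrite /tmap tliftE //; apply: bilin_comp (tpure_bilin _ _) _ _.
Qed.

Lemma tmap_linear U U' V V' (f : U -> U') (h : V -> V') :
  linear f -> linear h -> linear (tmap f h).
Proof.
by move=> fl hl; apply: tlift_linear; apply: bilin_comp (tpure_bilin _ _) _ _.
Qed.

Lemma leib_linear U (f : U -> U) : linear f -> linear (leib f).
Proof.
move=> fl a s t; rewrite /leib (tmap_linear fl (@linear_id U)).
by rewrite (tmap_linear (@linear_id U) fl) scalerDr addrACA.
Qed.

Lemma leibE U (f : U -> U) x y :
  linear f -> leib f (x \ox y) = f x \ox y + x \ox f y.
Proof. by move=> fl; rewrite /leib !tmapE. Qed.

Lemma leib_lc U a (f h : U -> U) t : linear f -> linear h ->
  leib (fun x => a *: f x + h x) t = a *: leib f t + leib h t.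
Proof.
move=> fl hl; have lcl := linear_lc a fl hl.
move: t; apply: tensor_ext => [||x y].
- exact: leib_linear.
- by apply: linear_lc; apply: leib_linear.
have [bl br] := tpure_bilin U U; rewrite !leibE //.
by rewrite (bl y a (f x) (h x)) (br x a (f y) (h y)) scalerDr addrACA.
Qed.

Lemma leib_comm U (f h : U -> U) t : linear f -> linear h ->
  leib (fun x => f (h x) - h (f x)) t = leib f (leib h t) - leib h (leib f t).
Proof.
move=> fl hl.
have fhl := linear_comp fl hl; have hfl := linear_comp hl fl.
have cl := linear_sub fhl hfl.
have lf := leib_linear fl; have lh := leib_linear hl.
move: t; apply: tensor_ext => [||x y].
- exact: leib_linear.
- by apply: linear_sub; apply: linear_comp.
have [bl br] := tpure_bilin U U.
have BB (V : lmodType K) (k : U -> V) : linear k -> forall u v, k (u - v) = k u - k v.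
  by move=> /linear_ex[k' ->] u v; rewrite raddfB.
have DD (k : tensor U U -> tensor U U) : linear k -> forall u v, k (u + v) = k u + k v.
  by move=> /linear_ex[k' ->] u v; rewrite raddfD.
rewrite !leibE // (BB _ _ (bl y)) (BB _ _ (br x)) (DD _ lf) (DD _ lh) !leibE //.
set A := f (h x) \ox y; set B := h (f x) \ox y.
set C := x \ox f (h y); set D := x \ox h (f y).
set E := h x \ox f y; set F := f x \ox h y.
have -> : A + E + (F + C) = A + C + (E + F) by rewrite [F + C]addrC addrACA.
have -> : B + F + (E + D) = B + D + (E + F).
  by rewrite [E + D]addrC addrACA [F + E]addrC.
by rewrite opprD [RHS]addrACA subrr addr0 opprD [RHS]addrACA.
Qed.
Definition trilin U V W X (f : U -> V -> W -> X) : Prop :=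
  (forall w, bilin (fun u v => f u v w)) /\ (forall u v, linear (f u v)).

Lemma tlift3_bilin U V W X (f : U -> V -> W -> X) :
  trilin f -> bilin (fun p w => tlift (fun u v => f u v w) p).
Proof.
move=> [fb fl]; have tl w := tlift_linear (fb w).
split=> [w|p a w w']; first exact: tl.
elim/tensor_ind: p => [|s t hs ht|u v]; last by rewrite !tliftE // fl.
  have t0 z : tlift (fun u v => f u v z) 0 = 0.
    by have [k ->] := linear_ex (tl z); rewrite raddf0.
  by rewrite !t0 scaler0 addr0.
have tD z : tlift (fun u v => f u v z) (s + t) =
    tlift (fun u v => f u v z) s + tlift (fun u v => f u v z) t.
  by have [k ->] := linear_ex (tl z); rewrite raddfD.
by rewrite !tD hs ht scalerDr addrACA.
Qed.

Lemma tlift3E U V W X (f : U -> V -> W -> X) u v w :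
  trilin f -> tlift3 f (u \ox v \ox w) = f u v w.
Proof.
move=> ft; rewrite /tlift3 tliftE; last exact: tlift3_bilin.
by rewrite tliftE //; apply: ft.1.
Qed.

Lemma tlift3_linear U V W X (f : U -> V -> W -> X) :
  trilin f -> linear (tlift3 f).
Proof. by move=> ft; apply/tlift_linear/tlift3_bilin. Qed.

Lemma tensor_ext3 U V W X (h k : tensor (tensor U V) W -> X) :
  linear h -> linear k ->
  (forall u v w, h (u \ox v \ox w) = k (u \ox v \ox w)) -> h =1 k.
Proof.
move=> hl kl e; apply: tensor_ext => // p w; move: p.
have pl : linear (fun p : tensor U V => p \ox w) by apply: (tpure_bilin _ _).1.
apply: tensor_ext => [||u v]; last exact: e.
- exact: linear_comp hl pl.
- exact: linear_comp kl pl.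
Qed.

Lemma trilinD U V W X (f h : U -> V -> W -> X) :
  trilin f -> trilin h -> trilin (fun u v w => f u v w + h u v w).
Proof.
move=> [fb fl] [hb hl]; split=> [w|u v a w w']; last first.
  by rewrite fl hl scalerDr addrACA.
split=> [v a u u'|u a v v'] /=.
  by rewrite ((fb w).1 v a u u') ((hb w).1 v a u u') scalerDr addrACA.
by rewrite ((fb w).2 u a v v') ((hb w).2 u a v v') scalerDr addrACA.
Qed.

Lemma trilinN U V W X (f : U -> V -> W -> X) :
  trilin f -> trilin (fun u v w => - f u v w).
Proof.
move=> [fb fl]; split=> [w|u v a w w']; last by rewrite fl opprD scalerN.
split=> [v a u u'|u a v v'] /=.
  by rewrite ((fb w).1 v a u u') opprD scalerN.
by rewrite ((fb w).2 u a v v') opprD scalerN.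
Qed.

Lemma trilin_tpure U V W : trilin (fun (u : U) (v : V) (w : W) => u \ox v \ox w).
Proof.
split=> [w|u v a w w']; last exact: (tpure_bilin _ _).2.
have wl : linear (fun p : tensor U V => p \ox w) by apply: (tpure_bilin _ _).1.
split=> [v|u]; apply: (linear_comp wl).
  exact: (tpure_bilin _ _).1.
exact: (tpure_bilin _ _).2.
Qed.

Lemma trilin12 U V W X (f : U -> V -> W -> X) :
  trilin f -> trilin (fun v u w => f u v w).
Proof. by move=> [fb fl]; split=> [w|v u]; [split=> [u|v]; apply (fb w) | apply: fl]. Qed.

Lemma trilin23 U V W X (f : U -> V -> W -> X) :
  trilin f -> trilin (fun u w v => f u v w).
Proof.
move=> [fb fl]; split=> [v|u w]; last exact: (fb w).2.
by split=> [w|u]; [apply (fb w) | apply: fl].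
Qed.

Lemma trilin_Alt U : trilin (fun x y z : U =>
  x \ox y \ox z + y \ox z \ox x + z \ox x \ox y
  - y \ox x \ox z - x \ox z \ox y - z \ox y \ox x).
Proof.
have t := trilin_tpure U U U.
have t12 := trilin12 t; have t23 := trilin23 t.
have tc := trilin12 t23; have tc' := trilin23 t12; have t13 := trilin12 tc'.
by repeat first [exact: t | exact: t12 | exact: t23 | exact: tc | exact: tc'
  | exact: t13 | apply: trilinN | apply: trilinD].
Qed.

Lemma Alt3_linear U : linear (@Alt3 K U).
Proof. exact/tlift3_linear/trilin_Alt. Qed.

Lemma Alt3E U (x y z : U) : Alt3 (x \ox y \ox z) =
  x \ox y \ox z + y \ox z \ox x + z \ox x \ox y
  - y \ox x \ox z - x \ox z \ox y - z \ox y \ox x.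
Proof. by rewrite /Alt3 tlift3E //; apply: trilin_Alt. Qed.
End TensorMapTheory.

HB.mixin Record Lmodule_isLieAlgebra (K : fieldType) L of GRing.Lmodule K L := {
  lieb : L -> L -> L;
  liebP : lie_bracket lieb
}.
#[short(type="lieAlgType")]
HB.structure Definition LieAlgebra (K : fieldType) :=
  { L of GRing.Lmodule K L & Lmodule_isLieAlgebra K L }.

HB.mixin Record Lmodule_isLieCoalgebra (K : fieldType) V of GRing.Lmodule K V := {
  cobr : V -> tensor V V;
  cobrP : lie_cobracket cobr
}.
#[short(type="lieCoalgType")]
HB.structure Definition LieCoalgebra (K : fieldType) :=
  { V of GRing.Lmodule K V & Lmodule_isLieCoalgebra K V }.

#[short(type="finLieCoalgType")]
HB.structure Definition FinLieCoalgebra (K : fieldType) :=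
  { V of LieCoalgebra K V & Vector K V }.

HB.mixin Record LieAlgebra_isLieBialgebra (K : fieldType) L
    of LieAlgebra K L & LieCoalgebra K L := {
  cobr_cocycle : cocycle (lieb : L -> L -> L) (cobr : L -> tensor L L)
}.
#[short(type="lieBialgType")]
HB.structure Definition LieBialgebra (K : fieldType) :=
  { L of LieAlgebra K L & LieCoalgebra K L & LieAlgebra_isLieBialgebra K L }.

Definition lie_bialgebra_structure (K : fieldType) (L : lieAlgType K)
    (co : L -> tensor L L) : Prop :=
  lie_cobracket co /\ cocycle lieb co.

Definition derivation (K : fieldType) (g : lieAlgType K) (D : g -> g) : Prop :=
  linear D /\ forall x y, D (lieb x y) = lieb (D x) y + lieb x (D y).

Definition coderivation (K : fieldType) (g : lieCoalgType K) (D : g -> g) : Prop :=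
  linear D /\ forall x, leib D (cobr x) = cobr (D x).

Section Biderivations.
Context (K : fieldType) (g : lieBialgType K).

Definition biderivation : {pred g -> g} :=
  fun D => `[< derivation D /\ coderivation D >].

(* A Lie algebra for the commutator, see bider_lieb. *)
Record BiDer := MkBiDer {
  bider_fun :> g -> g;
  _ : bider_fun \in biderivation
}.
HB.instance Definition _ := [isSub for bider_fun].
HB.instance Definition _ := [Choice of BiDer by <:].

Lemma biderivationP (D : BiDer) : derivation D /\ coderivation D.
Proof. by case: D => D /= /asboolP. Qed.

Lemma bider_linear (D : BiDer) : linear D.
Proof. by have [[]] := biderivationP D. Qed.

Let liebl (y : g) : linear (lieb^~ y).
Proof. by have [[]] := @liebP K g. Qed.
Let liebr (x : g) : linear (lieb x).
Proof. by have [[]] := @liebP K g. Qed.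
Let cobr_lin : linear (cobr : g -> tensor g g).
Proof. by have [] := @cobrP K g. Qed.

Let linB (U V : lmodType K) (f : U -> V) : linear f -> {morph f : x y / x - y}.
Proof. by move=> /linear_ex[h ->] x y; rewrite raddfB. Qed.

Fact biderivation_lc a (D E : g -> g) :
  D \in biderivation -> E \in biderivation -> a *: D + E \in biderivation.
Proof.
move=> /asboolP[[Dl Dd] [_ Dc]] /asboolP[[El Ed] [_ Ec]]; apply/asboolP.
have lcl : linear (fun x => a *: D x + E x) by apply: linear_lc.
have -> : a *: D + E = fun x => a *: D x + E x by [].
split; (split; first exact: lcl).
- by move=> x y; rewrite (liebl y) (liebr x) Dd Ed scalerDr addrACA.
- by move=> x; rewrite (leib_lc a _ Dl El) Dc Ec cobr_lin.
Qed.

Fact biderivation0 : (0 : g -> g) \in biderivation.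
Proof.
have lin0 : linear (fun _ : g => 0 : g) by move=> a x y; rewrite scaler0 addr0.
have lin_at0 (U V : lmodType K) (f : U -> V) : linear f -> f 0 = 0.
  by move=> /linear_ex[h ->]; rewrite raddf0.
apply/asboolP; have -> : (0 : g -> g) = fun=> 0 by [].
split; (split; first exact: lin0).
- by move=> x y; rewrite (lin_at0 _ _ _ (liebl y)) (lin_at0 _ _ _ (liebr x)) addr0.
- move=> x; rewrite (lin_at0 _ _ _ cobr_lin).
  have := leib_lc (-1) (cobr x) lin0 lin0.
  have -> : (fun _ : g => -1 *: 0 + 0) = fun=> 0 :> g.
    by apply/funext => y; rewrite scaler0 addr0.
  by move=> ->; rewrite scaleN1r addNr.
Qed.

Fact biderivation_submod_closed : submod_closed biderivation.
Proof.
by split; [exact: biderivation0 | move=> a D E hD hE; apply: biderivation_lc].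
Qed.

HB.instance Definition _ :=
  GRing.isSubmodClosed.Build K _ biderivation biderivation_submod_closed.
HB.instance Definition _ := [SubChoice_isSubLmodule of BiDer by <:].

Fact commutator_bider (D E : BiDer) :
  (fun x => D (E x) - E (D x)) \in biderivation.
Proof.
have [[Dl Dd] [_ Dc]] := biderivationP D; have [[El Ed] [_ Ec]] := biderivationP E.
have cl : linear (fun x => D (E x) - E (D x)).
  by apply: linear_sub; apply: linear_comp.
have addl (F : BiDer) u v : F (u + v) = F u + F v.
  by have [f ->] := linear_ex (bider_linear F); rewrite raddfD.
apply/asboolP; split; (split; first exact: cl); last first.
  by move=> x; rewrite leib_comm // Ec Dc Dc Ec -(linB cobr_lin).
move=> x y; rewrite Ed Dd !addl !Dd !Ed (linB (liebl y)) (linB (liebr x)).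
rewrite [lieb (E x) (D y) + _]addrC [X in _ - X]addrACA.
rewrite [lieb (D x) (E y) + lieb x _]addrC [X in X - _]addrACA.
rewrite [lieb (D x) (E y) + _]addrC opprD [LHS]addrACA subrr addr0.
by rewrite opprD [LHS]addrACA.
Qed.

Definition bider_lieb (D E : BiDer) : BiDer := MkBiDer (commutator_bider D E).

Fact bider_lieP : lie_bracket bider_lieb.
Proof.
have linE (F : BiDer) a u v : F (a *: u + v) = a *: F u + F v.
  exact: bider_linear.
split=> [|D|D E F].
- split=> [E a D D'|D a E E']; apply/val_inj/funext => x /=.
    rewrite -[RHS]/(a *: (D (E x) - E (D x)) + (D' (E x) - E (D' x))).
    rewrite -[LHS]/(a *: D (E x) + D' (E x) - E (a *: D x + D' x)).
    by rewrite linE opprD addrACA scalerBr.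
  rewrite -[RHS]/(a *: (D (E x) - E (D x)) + (D (E' x) - E' (D x))).
  rewrite -[LHS]/(D (a *: E x + E' x) - (a *: E (D x) + E' (D x))).
  by rewrite linE opprD addrACA scalerBr.
- by apply/val_inj/funext => x; rewrite /= subrr.
apply/val_inj/funext => x /=.
have linB_ (G : BiDer) u v : G (u - v) = G u - G v.
  exact: (linB (bider_linear G)).
pose b (D E F : BiDer) := D (E (F x)) - D (F (E x)) - (E (F (D x)) - F (E (D x))).
have bE (D1 E1 F1 : BiDer) : bider_lieb D1 (bider_lieb E1 F1) x = b D1 E1 F1.
  by rewrite /= linB_.
transitivity (b D E F + b E F D + b F D E); first by rewrite -!bE.
have zE (M : zmodType) (p q r s : M) : p - q - (r - s) = (p + s) - (r + q).
  by rewrite opprB addrACA -opprD [q + r]addrC.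
have tele (M : zmodType) (u v w : M) : u - v + (v - w) + (w - u) = 0.
  by rewrite [u - v + _]addrA subrK addrA subrK subrr.
by rewrite /b !zE tele.
Qed.

HB.instance Definition _ := Lmodule_isLieAlgebra.Build K BiDer bider_lieP.

End Biderivations.

Section LieMorphisms.
Context (K : fieldType).

Definition lie_morphism (g h : lieAlgType K) (f : g -> h) : Prop :=
  linear f /\ forall x y, f (lieb x y) = lieb (f x) (f y).

(* V with the zero bracket, whatever other structure V carries. *)
Definition abelian_lie (V : lmodType K) : Type := V.
HB.instance Definition _ (V : lmodType K) := GRing.Lmodule.on (abelian_lie V).

Fact abelian_lieP (V : lmodType K) :
  lie_bracket (fun _ _ : abelian_lie V => 0 : abelian_lie V).
Proof.
by split=> // [|x y z]; [split=> x a y z /=; rewrite scaler0 addr0 | rewrite !addr0].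
Qed.
HB.instance Definition _ (V : lmodType K) :=
  Lmodule_isLieAlgebra.Build K (abelian_lie V) (abelian_lieP V).

Definition prod_lieb (g h : lieAlgType K) (x y : g * h) : g * h :=
  (lieb x.1 y.1, lieb x.2 y.2).

Fact prod_lieP (g h : lieAlgType K) : lie_bracket (@prod_lieb g h).
Proof.
have [[gl gr] g0 gJ] := @liebP K g; have [[hl hr] h0 hJ] := @liebP K h.
split=> [|x|x y z].
- split=> u a x y; rewrite /prod_lieb /=.
    by rewrite (gl u.1 a x.1 y.1) (hl u.2 a x.2 y.2).
  by rewrite (gr u.1 a x.1 y.1) (hr u.2 a x.2 y.2).
- by rewrite /prod_lieb g0 h0.
by apply: injective_projections; [exact: gJ | exact: hJ].
Qed.
HB.instance Definition _ (g h : lieAlgType K) :=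
  Lmodule_isLieAlgebra.Build K (g * h)%type (@prod_lieP g h).

End LieMorphisms.

Section DualLieAlgebra.
Context (K : fieldType) (V : finLieCoalgType K).

Definition lie_dual : Type := 'Hom(V, K^o).
HB.instance Definition _ := Vector.on lie_dual.

Implicit Types f h k : lie_dual.

(* The bracket on the dual is the transpose of the cobracket; lieb_dual_basis
   gives it in terms of structure constants. *)
Definition dual_pairing f h : tensor V V -> K^o :=
  tlift (fun x y => (f : 'Hom(V, K^o)) x * (h : 'Hom(V, K^o)) y).

Definition dual_lieb f h : lie_dual := linfun (fun v => dual_pairing f h (cobr v)).

Lemma dual_pairing_bilin f h :
  bilin (fun x y : V => (f : 'Hom(V, K^o)) x * (h : 'Hom(V, K^o)) y : K^o).
Proof.
split=> [v a x y|x a u v] /=; rewrite linearP.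
  by rewrite mulrDl -mulrA.
by rewrite mulrDr [_ * (a *: _)]mulrCA.
Qed.

Lemma dual_pairing_linear f h : linear (dual_pairing f h).
Proof. exact/tlift_linear/dual_pairing_bilin. Qed.

Lemma dual_pairingE f h x y :
  dual_pairing f h (x \ox y) = (f : 'Hom(V, K^o)) x * (h : 'Hom(V, K^o)) y.
Proof. by rewrite /dual_pairing tliftE //; apply: dual_pairing_bilin. Qed.

Lemma cobr_linear : linear (cobr : V -> tensor V V).
Proof. by have [] := @cobrP K V. Qed.

Lemma dual_liebE f h v :
  (dual_lieb f h : 'Hom(V, K^o)) v = dual_pairing f h (cobr v).
Proof.
have [k kE] := linear_ex (linear_comp (dual_pairing_linear f h) cobr_linear).
by rewrite /dual_lieb kE lfunE /= -kE.
Qed.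

Lemma dual_pairing_wedge f h (t : tensor V V) :
  Lambda2 t -> dual_pairing f h t = - dual_pairing h f t.
Proof.
move=> [s ->].
have DZ (f1 f2 : lie_dual) a u v :
    dual_pairing f1 f2 (a *: u + v) = a * dual_pairing f1 f2 u + dual_pairing f1 f2 v.
  exact: dual_pairing_linear.
have D0 (f1 f2 : lie_dual) : dual_pairing f1 f2 0 = 0.
  by have [p ->] := linear_ex (dual_pairing_linear f1 f2); rewrite raddf0.
elim: s => [|[x y] s IHs]; first by rewrite big_nil !D0 oppr0.
rewrite big_cons /= -[wedge x y + _]/(2^-1 *: (x \ox y - y \ox x) + _) !DZ IHs.
rewrite -(scaleN1r (y \ox x)) ![x \ox y + _]addrC !DZ !dual_pairingE.
rewrite opprD -mulrN opprD !mulN1r opprK [h y * _ + _]addrC.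
by congr (2^-1 * (_ + _) - _); rewrite mulrC.
Qed.

Let pairing3 f h k : tensor (tensor V V) V -> K^o :=
  tlift (fun p z => dual_pairing f h p * (k : 'Hom(V, K^o)) z).

Let pairing3_bilin f h k : bilin (fun (p : tensor V V) (z : V) =>
  dual_pairing f h p * (k : 'Hom(V, K^o)) z : K^o).
Proof.
split=> [v a x y|x a u v] /=.
  by rewrite dual_pairing_linear mulrDl -mulrA.
by rewrite linearP mulrDr [_ * (a *: _)]mulrCA.
Qed.

Let pairing3_linear f h k : linear (pairing3 f h k).
Proof. exact/tlift_linear/pairing3_bilin. Qed.

Let pairing3E f h k p z :
  pairing3 f h k (p \ox z) = dual_pairing f h p * (k : 'Hom(V, K^o)) z.
Proof. by rewrite /pairing3 tliftE //; apply: pairing3_bilin. Qed.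

Let coco (v : V) := tmap (cobr : V -> tensor V V) (idfun : V -> V) (cobr v).

Let pairing_lieb f h k v :
  dual_pairing (dual_lieb f h) k (cobr v) = pairing3 f h k (coco v).
Proof.
rewrite /coco; move: (cobr v); apply: tensor_ext => [||x y].
- exact: dual_pairing_linear.
- by apply: linear_comp (pairing3_linear f h k) _; apply: tmap_linear cobr_linear _.
rewrite dual_pairingE dual_liebE tmapE; last exact: linear_id.
  by rewrite pairing3E.
exact: cobr_linear.
Qed.

Let cobr_wedge (v : V) : Lambda2 (cobr v).
Proof. by have [] := @cobrP K V. Qed.

Let pairing3N f h k v : pairing3 f h k (coco v) = - pairing3 h f k (coco v).
Proof. 
rewrite -!pairing_lieb; move: (cobr v).
have linN (g : tensor V V -> K^o) : linear g -> linear (fun t => - g t).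
  by move=> gl a x y; rewrite gl opprD scalerN.
apply: tensor_ext => [||x y].
- exact: dual_pairing_linear.
- exact/linN/dual_pairing_linear.
by rewrite !dual_pairingE !dual_liebE (dual_pairing_wedge _ _ (cobr_wedge x)) mulNr.
Qed.

Let pairing3_Alt f h k t : pairing3 f h k (Alt3 t) =
  pairing3 f h k t + pairing3 k f h t + pairing3 h k f t
  - pairing3 h f k t - pairing3 f k h t - pairing3 k h f t.
Proof.
have lD (g1 g2 : tensor (tensor V V) V -> K^o) :
    linear g1 -> linear g2 -> linear (fun t => g1 t + g2 t).
  by move=> gl1 gl2 a x y; rewrite gl1 gl2 scalerDr addrACA.
move: t; apply: tensor_ext3 => [||x y z].
- by apply: linear_comp; [exact: pairing3_linear | exact: Alt3_linear].
- have L := pairing3_linear.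
  exact: (linear_sub (linear_sub (linear_sub
    (lD _ _ (lD _ _ (L _ _ _) (L _ _ _)) (L _ _ _)) (L _ _ _)) (L _ _ _))
    (L _ _ _)).
rewrite Alt3E.
have [p pE] := linear_ex (pairing3_linear f h k).
have pE' t : p t = pairing3 f h k t by rewrite -pE.
rewrite -[LHS]pE' !raddfB !raddfD /= !pE' !pairing3E !dual_pairingE.
by rewrite /=; ring.
Qed.

Let Lambda2_char2 (t : tensor V V) : 2 = 0 :> K -> Lambda2 t -> t = 0.
Proof.
by move=> z2 [s ->]; apply: big1 => p _; rewrite /wedge z2 invr0 scale0r.
Qed.

Let pairing3_cyc f h k v :
  pairing3 f h k (coco v) + pairing3 k f h (coco v) + pairing3 h k f (coco v) = 0.
Proof.
have [_ _ /(_ v) A0] := @cobrP K V.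
have p0 (b : tensor (tensor V V) V -> K^o) : linear b -> b 0 = 0.
  by move=> /linear_ex[c ->]; rewrite raddf0.
have := pairing3_Alt f h k (coco v).
rewrite A0 (p0 _ (pairing3_linear _ _ _)).
rewrite (pairing3N h f k) (pairing3N f k h) (pairing3N k h f) !opprK.
move=> e; set S : K := LHS.
have e2 : 2 * S = 0.
  have R (a b c : K) : 2 * (a + b + c) = a + b + c + a + b + c by ring.
  by rewrite [RHS]e; exact: R.
have /eqP := e2; rewrite mulf_eq0 => /orP[/eqP z2|/eqP//].
rewrite /S /coco (Lambda2_char2 z2 (cobr_wedge v)).
have -> : tmap (cobr : V -> tensor V V) (idfun : V -> V) 0 = 0.
  by have [c ->] := linear_ex (tmap_linear cobr_linear (@linear_id K V)); rewrite raddf0.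
by rewrite !(p0 _ (pairing3_linear _ _ _)) !addr0.
Qed.

Let dual_pairing_lin a f f' h (t : tensor V V) :
  dual_pairing (a *: f + f') h t = a * dual_pairing f h t + dual_pairing f' h t.
Proof.
have dl := dual_pairing_linear; move: t; apply: tensor_ext => [||x y].
- exact: dl.
- exact: (linear_lc a (dl f h) (dl f' h)).
rewrite !dual_pairingE mulrA -mulrDl; congr (_ * _).
by rewrite add_lfunE scale_lfunE.
Qed.

Let dual_liebN f h : dual_lieb f h = - dual_lieb h f.
Proof.
apply/lfunP => v; rewrite opp_lfunE !dual_liebE.
exact/dual_pairing_wedge/cobr_wedge.
Qed.

Let dual_lieb_lin h : linear (dual_lieb^~ h).
Proof.
move=> a f f' /=; apply/lfunP => v.
by rewrite add_lfunE scale_lfunE !dual_liebE dual_pairing_lin.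
Qed.

Fact dual_lieP : lie_bracket dual_lieb.
Proof.
split=> [|f|f h k].
- split=> [h|f a h h']; first exact: dual_lieb_lin.
  by rewrite !(dual_liebN f) dual_lieb_lin opprD scalerN.
- apply/lfunP => v; rewrite dual_liebE zero_lfunE.
  have [_ /(_ v)[s ->] _] := @cobrP K V.
  have DZ a u w :
      dual_pairing f f (a *: u + w) = a * dual_pairing f f u + dual_pairing f f w.
    exact: dual_pairing_linear.
  elim: s => [|[x y] s IHs].
    by rewrite big_nil; have [p ->] := linear_ex (dual_pairing_linear f f); rewrite raddf0.
  rewrite big_cons /= -[wedge x y + _]/(2^-1 *: (x \ox y - y \ox x) + _) DZ IHs.
  rewrite -(scaleN1r (y \ox x)) [x \ox y + _]addrC DZ !dual_pairingE.
  by rewrite mulN1r [X in - X]mulrC addNr mulr0 addr0.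
apply/lfunP => v; rewrite (dual_liebN f (dual_lieb h k)).
rewrite (dual_liebN h (dual_lieb k f)) (dual_liebN k (dual_lieb f h)).
rewrite zero_lfunE !add_lfunE !opp_lfunE !dual_liebE !pairing_lieb -!opprD.
by rewrite addrC addrA addrAC pairing3_cyc oppr0.
Qed.

HB.instance Definition _ := Lmodule_isLieAlgebra.Build K lie_dual dual_lieP.

End DualLieAlgebra.

Section DualBasis.
Context (K : fieldType) (V : finLieCoalgType K) (d : nat) (t : d.-tuple V).

Definition dual_basis (i : 'I_d) : lie_dual V := linfun (coord t i : V -> K^o).

Lemma dual_basisE (i j : 'I_d) : basis_of fullv t ->
  (dual_basis i : 'Hom(V, K^o)) t`_j = (i == j)%:R.
Proof. by move=> tb; rewrite lfunE /= coord_free ?(basis_free tb) 1?eq_sym. Qed.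

Lemma lieb_dual_basis (c : 'I_d -> 'I_d -> 'I_d -> K) : basis_of fullv t ->
  2 != 0 :> K -> (forall k i j, c k i j = - c k j i) ->
  (forall k : 'I_d, cobr (t`_k) = \sum_i \sum_j c k i j *: wedge t`_i t`_j) ->
  forall i j, lieb (dual_basis i) (dual_basis j) = \sum_k c k i j *: dual_basis k.
Proof.
move=> tb nz2 cN co i j; apply/lfunP => v.
have tE (k a : 'I_d) : (dual_basis k : 'Hom(V, K^o)) t`_a = (a == k)%:R.
  by rewrite dual_basisE // eq_sym.
have onb (l : 'Hom(V, K^o)) : l v = \sum_k coord t k v * l t`_k.
  by rewrite {1}(coord_basis tb (memvf v)) linear_sum; apply: eq_bigr => k _; rewrite linearZ.
rewrite [LHS]onb [RHS]onb; apply: eq_bigr => k _; congr (_ * _).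
transitivity (c k i j); last first.
  rewrite sum_lfunE (bigD1 k) //= scale_lfunE tE eqxx big1 ?addr0 => [|l /negPf lk].
    exact/esym/(mulr1 (c k i j)).
  by rewrite scale_lfunE tE eq_sym lk; exact: (mulr0 (c l i j)).
rewrite -[LHS]/((dual_lieb _ _ : 'Hom(V, K^o)) _) dual_liebE co.
have dpS (I : finType) (F : I -> tensor V V) :
  dual_pairing (dual_basis i) (dual_basis j) (\sum_a F a) =
  \sum_a dual_pairing (dual_basis i) (dual_basis j) (F a).
  by have [p ->] := linear_ex (dual_pairing_linear (dual_basis i) (dual_basis j));
    rewrite raddf_sum.
have dpZ a w : dual_pairing (dual_basis i) (dual_basis j) (a *: w) =
  a * dual_pairing (dual_basis i) (dual_basis j) w.
  by have [p ->] := linear_ex (dual_pairing_linear (dual_basis i) (dual_basis j));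
    rewrite linearZ.
have dpB w w' : dual_pairing (dual_basis i) (dual_basis j) (w - w') =
  dual_pairing (dual_basis i) (dual_basis j) w
  - dual_pairing (dual_basis i) (dual_basis j) w'.
  by have [p ->] := linear_ex (dual_pairing_linear (dual_basis i) (dual_basis j));
    rewrite raddfB.
rewrite dpS.
transitivity (\sum_a \sum_b c k a b * (2^-1 *
    ((a == i)%:R * (b == j)%:R - (b == i)%:R * (a == j)%:R))).
  apply: eq_bigr => a _; rewrite dpS; apply: eq_bigr => b _.
  by rewrite dpZ /wedge dpZ dpB !dual_pairingE !tE.
have -> : c k i j = 2^-1 * (c k i j - c k j i).
  by rewrite -cN -mulr2n -[c k i j *+ 2]mulr_natl mulKf.
have sel (F : 'I_d -> 'I_d -> K) (p q : 'I_d) :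
    \sum_a \sum_b F a b * ((a == p)%:R * (b == q)%:R) = F p q.
  rewrite (bigD1 p) //= [X in _ + X]big1 ?addr0 => [|a /negPf ap]; last first.
    by apply: big1 => b _; rewrite ap mul0r mulr0.
  rewrite (bigD1 q) //= big1 ?addr0 => [|b /negPf bq]; last by rewrite bq !mulr0.
  by rewrite !eqxx !mulr1.
rewrite -(sel (c k) i j) -(sel (c k) j i) -sumrB mulr_sumr; apply: eq_bigr => a _.
rewrite -sumrB mulr_sumr; apply: eq_bigr => b _.
by rewrite mulrCA mulrBr [(b == i)%:R * _]mulrC.
Qed.
End DualBasis.

(* Main.v *)
Require Import Defs.
From HB Require Import structures.
From mathcomp Require Import all_boot all_algebra.

Set Implicit Arguments.
Unset Strict Implicit.
Unset Printing Implicit Defensive.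

Import GRing.Theory.
Local Open Scope ring_scope.

(** The wedge is half an antisymmetrised tensor, so the proposed cobracket is
    delta(x) = delta_g(x) + sum_i (D_i x (x) t_i - t_i (x) D_i x) on g, and
    delta(v) = delta_V(v) on V. It has values in Lambda^2, and the two axioms are
    checked according to the number of tensor factors that lie in V.

    Cocycle. V is central in g * V, so ad_(x+v) acts on the factors in g as ad_x
    and kills those in V. The part in g (x) g is then the cocycle condition of g.
    The mixed part says D_i [x, y] = [x, D_i y] - [y, D_i x] for each i, which
    holds as D_i is a derivation. On the part in V (x) V both sides vanish.

    Co-Jacobi. On V it is co-Jacobi for delta_V. For x in g, apply delta to the
    first factor of delta(x) and then Alt.
    - No factor in V: co-Jacobi for delta_g.
    - One factor in V: the derivation action of D_i on delta_g(x) meets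
      delta_g(D_i x) with the opposite sign, both tensored with t_i, and they
      cancel because D_i is a coderivation ([Alt3_tmap_skewr] produces the
      derivation action).
    - Two factors in V: the terms D_j D_i x (x) t_i (x) t_j alternate into the
      commutators [D_i, D_j] x, which must match the terms
      delta_V(t_k) (x) D_k x. As the coordinates of delta_V(t_k) are the
      structure constants of the dual Lie algebra, this is the statement that
      the t_i^* |-> D_i form a Lie morphism ([GVV_component]).
    The antisymmetry of Alt, [Alt3_rot] and [Alt3_swap], reduces each component
    to a single order of its factors. *)

(** * Linear structure of the tensor operations *)

Section TensorLinear.
Context (K : fieldType).
Implicit Types U V W X : lmodType K.

HB.instance Definition _ U U' V V' (f : {linear U -> U'}) (h : {linear V -> V'}) :=
  GRing.isLinear.Build K (tensor U V) (tensor U' V') *:%R (tmap f h)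
    (tmap_linear (linearP f) (linearP h)).

HB.instance Definition _ U :=
  GRing.isLinear.Build K _ _ *:%R (@Alt3 K U) (@Alt3_linear K U).

HB.instance Definition _ U V (u : U) :=
  GRing.isLinear.Build K V (tensor U V) *:%R (tpure u) ((tpure_bilin U V).2 u).

(** Carries the linear structure in the first factor, as the partial
    application [tpure u] does in the second. *)
Definition tpurer U V (v : V) (u : U) := u \ox v.

HB.instance Definition _ U V (v : V) :=
  GRing.isLinear.Build K U (tensor U V) *:%R (tpurer v) ((tpure_bilin U V).1 v).

HB.instance Definition _ (V : lieCoalgType K) :=
  GRing.isLinear.Build K V (tensor V V) *:%R cobr
    (let: And3 h _ _ := @cobrP K V in h).

HB.instance Definition _ (g : lieBialgType K) (D : BiDer g) :=
  GRing.isLinear.Build K g g *:%R D (bider_linear D).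

HB.instance Definition _ (g : lieAlgType K) (x : g) :=
  GRing.isLinear.Build K g g *:%R (lieb x)
    (let: And3 h _ _ := @liebP K g in h.2 x).

HB.instance Definition _ U (f : {linear U -> U}) :=
  GRing.isLinear.Build K _ _ *:%R (leib f) (leib_linear (linearP f)).

Lemma tpure0l U V (v : V) : (0 : U) \ox v = 0.
Proof. exact: (linear0 (tpurer v)). Qed.

Lemma tpure0r U V (u : U) : u \ox (0 : V) = 0.
Proof. exact: (linear0 (tpure u)). Qed.

Lemma tpureDl U V (u u' : U) (v : V) : (u + u') \ox v = u \ox v + u' \ox v.
Proof. exact: (linearD (tpurer v)). Qed.

Lemma tpureZl U V a (u : U) (v : V) : (a *: u) \ox v = a *: (u \ox v).
Proof. exact: (linearZ_LR (tpurer v)). Qed.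

Lemma tpureBl U V (u u' : U) (v : V) : (u - u') \ox v = u \ox v - u' \ox v.
Proof. exact: (linearB (tpurer v)). Qed.

Lemma tpure_suml U V (I : finType) (F : I -> U) (v : V) :
  (\sum_i F i) \ox v = \sum_i F i \ox v.
Proof. exact: (linear_sum (tpurer v)). Qed.

Lemma tpureZr U V a (u : U) (v : V) : u \ox (a *: v) = a *: (u \ox v).
Proof. exact: (linearZ_LR (tpure u)). Qed.

Lemma tmap_pure U U' V V' (f : {linear U -> U'}) (h : {linear V -> V'}) u v :
  tmap f h (u \ox v) = f u \ox h v.
Proof. by rewrite tmapE //; apply: linearP. Qed.

Lemma tmap_comp U U' U'' V V' V'' (f' : {linear U' -> U''}) (f : {linear U -> U'})
    (h' : {linear V' -> V''}) (h : {linear V -> V'}) s :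
  tmap f' h' (tmap f h s) = tmap (f' \o f) (h' \o h) s.
Proof.
move: s; apply: tensor_ext => [||u v]; first exact: (linearP (tmap f' h' \o tmap f h)).
  exact: linearP.
by rewrite !tmap_pure.
Qed.

Lemma leib_tmap U V (f : {linear U -> V}) (E : {linear U -> U})
    (F : {linear V -> V}) s :
  (forall x, F (f x) = f (E x)) -> leib F (tmap f f s) = tmap f f (leib E s).
Proof.
move=> FE; move: s; apply: tensor_ext => [||x y].
- exact: (linearP (leib F \o tmap f f)).
- exact: (linearP (tmap f f \o leib E)).
rewrite tmap_pure !leibE; try exact: linearP.
by rewrite (linearD (tmap f f)) /= !tmap_pure !FE.
Qed.

Lemma leib_tmap_eq0 U V (f : {linear U -> V}) (F : {linear V -> V}) s :
  (forall x, F (f x) = 0) -> leib F (tmap f f s) = 0.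
Proof.
move=> F0; have -> : leib F (tmap f f s) = tmap f f (leib \0 s).
  by apply: leib_tmap => x; rewrite F0 linear0.
have -> : leib \0 s = 0; last exact: linear0.
move: s; apply: tensor_ext => [||x y]; first exact: (linearP (leib \0)).
  exact: (linearP \0).
rewrite (leibE _ _ (linearP \0)) /=.
by rewrite tpure0l tpure0r addr0.
Qed.

(** * Antisymmetric tensors and the alternator *)

Lemma wedge_tmap U V (f : {linear U -> V}) x y :
  tmap f f (wedge x y) = wedge (f x) (f y).
Proof. by rewrite /wedge linearZ linearB /= !tmap_pure. Qed.

Lemma Lambda2D U (s s' : tensor U U) : Lambda2 s -> Lambda2 s' -> Lambda2 (s + s').
Proof. by move=> [q ->] [q' ->]; exists (q ++ q'); rewrite big_cat. Qed.

Lemma Lambda2Z U a (s : tensor U U) : Lambda2 s -> Lambda2 (a *: s).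
Proof.
move=> [q ->]; exists [seq (a *: p.1, p.2) | p <- q].
rewrite big_map scaler_sumr; apply: eq_bigr => p _.
by rewrite /wedge /= tpureZl tpureZr -scalerBr !scalerA mulrC.
Qed.

Lemma Lambda2_tmap U V (f : {linear U -> V}) (s : tensor U U) :
  Lambda2 s -> Lambda2 (tmap f f s).
Proof.
move=> [q ->]; exists [seq (f p.1, f p.2) | p <- q].
by rewrite big_map linear_sum; apply: eq_bigr => p _; rewrite /= wedge_tmap.
Qed.

Lemma Lambda2_sum U (I : finType) (x y : I -> U) :
  Lambda2 (\sum_i wedge (x i) (y i)).
Proof. by exists [seq (x i, y i) | i <- enum I]; rewrite big_map big_enum. Qed.

Lemma Lambda2_ext U X (h k : {linear tensor U U -> X}) s :
  (forall x y, h (wedge x y) = k (wedge x y)) -> Lambda2 s -> h s = k s.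
Proof. by move=> e [q ->]; rewrite !linear_sum; apply: eq_bigr => p _; apply: e. Qed.

(** The next two symmetries, which generate the sign rule under all of S_3, are
    what allows every component of the co-Jacobi expression to be brought to
    one standard order of the factors, instead of tracking each of the
    permuted components separately. *)
Lemma Alt3_rot U (x y z : U) : Alt3 (x \ox y \ox z) = Alt3 (y \ox z \ox x).
Proof. by rewrite !Alt3E [RHS](ACl (3*1*2*5*6*4)). Qed.

Lemma Alt3_swap U (x y z : U) : Alt3 (y \ox x \ox z) = - Alt3 (x \ox y \ox z).
Proof. by rewrite !Alt3E !opprD !opprK [RHS](ACl (4*5*6*1*2*3)). Qed.

Lemma Alt3_tmap U V (f : {linear U -> V}) s :
  Alt3 (tmap (tmap f f) f s) = tmap (tmap f f) f (Alt3 s).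
Proof.
move: s; apply: tensor_ext3 => [||x y z].
- exact: (linearP (@Alt3 K V \o tmap (tmap f f) f)).
- exact: (linearP (tmap (tmap f f) f \o @Alt3 K U)).
have fE a b c : tmap (tmap f f) f (a \ox b \ox c) = f a \ox f b \ox f c.
  by rewrite tmap_pure /= tmap_pure.
have FB : {morph tmap (tmap f f) f : p q / p - q} by exact: linearB.
have FD : {morph tmap (tmap f f) f : p q / p + q} by exact: linearD.
by rewrite fE !Alt3E !FB !FD !fE.
Qed.

(** Twice the wedge of [x] and [u], free of the factor 1/2. The fixed factor [u]
    comes first so that the partial application is the linear map of [x] that
    carries [D i x] into the mixed term of the cobracket. *)
Definition skewr U (u x : U) : tensor U U := x \ox u - u \ox x.

Fact skewr_linear U (u : U) : linear (skewr u).
Proof.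
by move=> a x y; rewrite /skewr tpureDl tpureZl linearP /= opprD addrACA -scalerBr.
Qed.
HB.instance Definition _ U u :=
  GRing.isLinear.Build K U (tensor U U) *:%R (skewr u) (skewr_linear u).

Lemma wedge_skewr U (x u : U) : 2 != 0 :> K -> 2 *: wedge x u = skewr u x.
Proof. by move=> nz2; rewrite /wedge scalerA divff // scale1r. Qed.

Lemma tmap_skewr U V W (f : {linear U -> V}) (h : {linear U -> W}) (u x : U) :
  tmap f h (skewr u x) = f x \ox h u - f u \ox h x.
Proof. by rewrite /skewr (linearB (tmap f h)) /= !tmap_pure. Qed.

Lemma leib_skewr U (F : {linear U -> U}) u x :
  F u = 0 -> leib F (skewr u x) = skewr u (F x).
Proof.
move=> Fu; rewrite /skewr (linearB (leib F)) /= !(leibE _ _ (linearP F)) Fu.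
by rewrite tpure0l tpure0r addr0 add0r.
Qed.

Lemma Alt3_skewr U (u x y : U) : Alt3 (skewr u x \ox y) = - 2 *: Alt3 (x \ox y \ox u).
Proof.
rewrite /skewr tpureBl linearB /= (Alt3_swap x u y).
rewrite (Alt3_rot x u) (Alt3_rot u y) (Alt3_swap x y).
by rewrite -opprD scaleNr opprK scaler_nat mulr2n.
Qed.

(** Moving [u] to the last factor costs a sign. The antisymmetry of [s] then
    trades half of the doubled term [e x \ox f y] for [f x \ox e y], and this is
    how the Leibniz action of [e] on [s] appears. *)
Lemma Alt3_tmap_skewr U W (f e : {linear U -> W}) (u : W) s : Lambda2 s ->
  Alt3 (tmap (skewr u \o e) f s) = - Alt3 ((tmap e f s + tmap f e s) \ox u).
Proof.
pose h := @Alt3 K W \o tmap (skewr u \o e) f.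
pose k := \- (@Alt3 K W \o tpurer u \o (tmap e f \+ tmap f e)).
apply: (@Lambda2_ext _ _ h k) => x y; rewrite /h /k /=.
rewrite /wedge (linearZ_LR (tmap (skewr u \o e) f)) (linearB (tmap (skewr u \o e) f)) /=.
rewrite (linearZ_LR (tmap e f)) (linearB (tmap e f)) /=.
rewrite (linearZ_LR (tmap f e)) (linearB (tmap f e)) /=.
have AB : {morph @Alt3 K W : p q / p - q} by exact: linearB.
have AD : {morph @Alt3 K W : p q / p + q} by exact: linearD.
have AZ a q : Alt3 (a *: q) = a *: Alt3 q :> tensor (tensor W W) W.
  exact: linearZ_LR.
rewrite !tmap_pure /= AZ AB !Alt3_skewr -scalerDr /tpurer tpureZl tpureDl !tpureBl.
rewrite AZ AD !AB (Alt3_swap (e y)) (Alt3_swap (e x)) [- Alt3 _ - _]addrC opprK.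
rewrite -scalerBr -scalerN; congr (_ *: _).
by rewrite -mulr2n -scaler_nat scaleNr.
Qed.

(** Co-Jacobi transported to the image of the coalgebra: this disposes of the
    components of the extended cobracket that come from [g] or [V] alone. *)
Lemma Alt3_cobr (C : lieCoalgType K) V (f : {linear C -> V}) (v : C) :
  Alt3 (tmap (tmap f f \o cobr) f (cobr v)) = 0.
Proof.
have [_ _ /(_ v) A0] := @cobrP K C.
have -> : tmap (tmap f f \o cobr) f (cobr v) =
          tmap (tmap f f) f (tmap cobr idfun (cobr v)).
  by rewrite tmap_comp.
by rewrite Alt3_tmap A0 linear0.
Qed.

Lemma liebN (h : lieAlgType K) (x y : h) : lieb x y = - lieb y x.
Proof.
have [[bl br] b0 _] := @liebP K h.
have Dl (u v w : h) : lieb (u + v) w = lieb u w + lieb v w.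
  by have := bl w 1 u v; rewrite !scale1r.
have := b0 (x + y); rewrite Dl !(linearD (lieb _)) /= !b0 add0r addr0.
by move=> /eqP; rewrite addr_eq0 => /eqP.
Qed.

End TensorLinear.

(** * Expansion in a basis and its dual *)

Section DualExpansion.
Context (K : fieldType) (V : finLieCoalgType K) (d : nat) (t : d.-tuple V).
Hypothesis t_basis : basis_of {:V} t.

Lemma tensor_dual_basis (s : tensor V V) :
  s = \sum_i \sum_j
        (dual_pairing (dual_basis t i) (dual_basis t j) s : K) *: (t`_i \ox t`_j).
Proof.
move: s; apply: tensor_ext => // [a r s|x y].
  rewrite scaler_sumr -big_split; apply: eq_bigr => i _.
  rewrite scaler_sumr -big_split; apply: eq_bigr => j _ /=.
  by rewrite dual_pairing_linear scalerDl scalerA.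
rewrite {1}(coord_basis t_basis (memvf x)) {1}(coord_basis t_basis (memvf y)).
rewrite tpure_suml; apply: eq_bigr => i _; rewrite linear_sum.
apply: eq_bigr => j _; rewrite dual_pairingE !lfunE /=.
by rewrite tpureZl tpureZr scalerA.
Qed.

Lemma lie_dual_expand (f : lie_dual V) :
  f = \sum_(k < d) ((f : 'Hom(V, K^o)) t`_k : K) *: dual_basis t k.
Proof.
apply/lfunP => v; rewrite sum_lfunE {1}(coord_basis t_basis (memvf v)) linear_sum.
apply: eq_bigr => k _; rewrite linearZ scale_lfunE lfunE /=.
exact: mulrC.
Qed.
End DualExpansion.

(** * Co-Jacobi for the extended cobracket *)

(** Co-Jacobi does not involve the bracket of the product, and it only has to be
    checked on the images of [g] and [V]; so the two inclusions are arbitrary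
    linear maps into a module [L]. *)
Section Extension.
Context (K : fieldType) (g : lieBialgType K) (V : finLieCoalgType K).
Context (d : nat) (t : d.-tuple V) (DD : lie_dual V -> BiDer g).
Context (L : lmodType K) (iG : {linear g -> L}) (iV : {linear V -> L}).
Hypothesis t_basis : basis_of {:V} t.
Hypothesis DD_morph : lie_morphism DD.
Let D i := DD (dual_basis t i).
Context (co : {linear L -> tensor L L}).
Hypothesis coG : forall x,
  co (iG x) = tmap iG iG (cobr x) + \sum_(i < d) skewr (iV t`_i) (iG (D i x)).
Hypothesis coV : forall v, co (iV v) = tmap iV iV (cobr v).

(** The structure constants of the dual Lie algebra are the coordinates of the
    cobracket of [V], so this is the morphism property of [DD] on the dual
    basis. *)
Lemma commutator_dual_basis i j x :
  D i (D j x) - D j (D i x) =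
  \sum_(k < d) (dual_pairing (dual_basis t i) (dual_basis t j) (cobr t`_k) : K) *: D k x.
Proof.
have [DDl DDb] := DD_morph.
have el : linear (fun f => DD f x) by move=> a f h; rewrite DDl.
have [e eE] := linear_ex el.
have eE' f : e f = DD f x by rewrite -eE.
transitivity (DD (lieb (dual_basis t i) (dual_basis t j)) x); first by rewrite DDb.
rewrite [lieb _ _](lie_dual_expand t_basis) -eE' linear_sum.
apply: eq_bigr => k _; rewrite linearZ /= eE'; congr (_ *: _).
exact: dual_liebE.
Qed.

Lemma Alt3_coV v : Alt3 (tmap co idfun (co (iV v))) = 0.
Proof.
rewrite coV tmap_comp -[RHS](Alt3_cobr iV v); congr Alt3.
move: (cobr v); apply: tensor_ext => [||a b]; try exact: linearP.
by rewrite !tmap_pure /= coV.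
Qed.

(** The component with one factor in [g] and two in [V]. Antisymmetry in the two
    factors from [V] turns the doubled composite [D j (D i x)] into a
    commutator, and [DD] being a Lie morphism turns the commutators into the
    cobracket of [V]. *)
Lemma GVV_component x :
  \sum_(i < d) \sum_(j < d) 2 *: Alt3 (iG (D j (D i x)) \ox iV t`_i \ox iV t`_j) =
  - \sum_(k < d) Alt3 (tmap iV iV (cobr t`_k) \ox iG (D k x)).
Proof.
pose B y (i j : 'I_d) := Alt3 (iG y \ox iV t`_i \ox iV t`_j).
have BN y i j : B y j i = - B y i j.
  by rewrite /B -Alt3_rot Alt3_swap Alt3_rot Alt3_rot Alt3_rot.
have Bl i j : linear (fun y => B y i j).
  by move=> a y z; rewrite /B linearP !tpureDl !tpureZl linearP.
have [b bE] : {b : 'I_d -> 'I_d -> {linear g -> tensor (tensor L L) L} |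
    forall i j y, B y i j = b i j y}.
  exists (fun i j => sval (linear_ex (Bl i j))) => i j y.
  by case: (linear_ex _) => h /= <-.
transitivity (- \sum_(i < d) \sum_(j < d) B (D i (D j x) - D j (D i x)) i j).
  rewrite -/B.
  transitivity (\sum_(i < d) \sum_(j < d) B (D j (D i x)) i j
                + \sum_(i < d) \sum_(j < d) B (D j (D i x)) i j).
    rewrite -big_split; apply: eq_bigr => i _; rewrite -big_split.
    by apply: eq_bigr => j _; rewrite scaler_nat mulr2n.
  (* Swapping i and j in one of the two copies produces the commutator. *)
  rewrite {2}exchange_big -big_split -sumrN; apply: eq_bigr => i _.
  rewrite -big_split -sumrN; apply: eq_bigr => j _ /=.
  by rewrite (BN _ i j) !bE linearB opprB.
congr (- _).
(* Collect, for each k, the coordinates of the cobracket of t`_k. *)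
transitivity (\sum_(i < d) \sum_(j < d) \sum_(k < d)
    (dual_pairing (dual_basis t i) (dual_basis t j) (cobr t`_k) : K) *: B (D k x) i j).
  apply: eq_bigr => i _; apply: eq_bigr => j _.
  rewrite commutator_dual_basis bE linear_sum; apply: eq_bigr => k _.
  by rewrite linearZ bE.
under eq_bigr do rewrite exchange_big.
rewrite exchange_big; apply: eq_bigr => k _ /=.
have [h hE] : {h : {linear tensor V V -> tensor (tensor L L) L} |
    forall s, h s = Alt3 (tmap iV iV s \ox iG (D k x))}.
  by exists (@Alt3 K L \o tpurer (iG (D k x)) \o tmap iV iV).
rewrite -hE [X in h X](tensor_dual_basis t_basis).
rewrite (linear_sum h); apply: eq_bigr => i _.
rewrite (linear_sum h); apply: eq_bigr => j _.
by rewrite (linearZ_LR h) /= hE tmap_pure /B Alt3_rot.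
Qed.

(** Besides the component in [g] alone, which is co-Jacobi for [g], there are two
    components. In the one with a single factor in [V], the cobracket of
    [D i x] cancels the Leibniz action of [D i] on the cobracket of [x], because
    [D i] is a coderivation; the other one is [GVV_component]. *)
Lemma Alt3_coG x : Alt3 (tmap co idfun (co (iG x))) = 0.
Proof.
have sk : Lambda2 (cobr x) by have [] := @cobrP K g.
have AB : {morph @Alt3 K L : p q / p - q} by exact: linearB.
have AD : {morph @Alt3 K L : p q / p + q} by exact: linearD.
have AS (F : 'I_d -> _) : Alt3 (\sum_i F i) = \sum_i Alt3 (F i) :> tensor (tensor L L) L.
  exact: linear_sum.
have GGV : Alt3 (tmap co idfun (tmap iG iG (cobr x))) =
    - \sum_(i < d) Alt3 (tmap iG iG (cobr (D i x)) \ox iV t`_i).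
  rewrite tmap_comp.
  have -> : tmap (co \o iG) (idfun \o iG) (cobr x) =
      tmap (tmap iG iG \o cobr) iG (cobr x)
      + \sum_(i < d) tmap (skewr (iV t`_i) \o (iG \o D i)) iG (cobr x).
    move: (cobr x); apply: tensor_ext => [||a b]; first exact: linearP.
      move=> a r s; rewrite linearP scalerDr addrACA; congr (_ + _).
      rewrite scaler_sumr -big_split; apply: eq_bigr => i _; exact: linearP.
    rewrite !tmap_pure /= coG tpureDl tpure_suml; congr (_ + _).
    by apply: eq_bigr => i _; rewrite tmap_pure.
  rewrite AD Alt3_cobr add0r AS -sumrN; apply: eq_bigr => i _.
  rewrite Alt3_tmap_skewr //; congr (- Alt3 (_ \ox _)).
  have [_ [_ <-]] := biderivationP (D i).
  by rewrite /leib (linearD (tmap iG iG)) /= !tmap_comp.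
rewrite coG (linearD (tmap co idfun)) AD GGV (linear_sum (tmap co idfun)) AS.
transitivity (- \sum_(i < d) \sum_(j < d)
      2 *: Alt3 (iG (D j (D i x)) \ox iV t`_i \ox iV t`_j)
    - \sum_(k < d) Alt3 (tmap iV iV (cobr t`_k) \ox iG (D k x))); last first.
  by rewrite GVV_component opprK subrr.
rewrite -!sumrN -!big_split; apply: eq_bigr => i _ /=.
rewrite tmap_skewr /= coG coV tpureDl tpure_suml AB AD.
rewrite addrA addrA addNr add0r; congr (_ - _).
rewrite AS -sumrN; apply: eq_bigr => j _.
by rewrite Alt3_skewr scaleNr.
Qed.
End Extension.

(** * The extended Lie bialgebra *)

Theorem theorem3p1 (K : fieldType) (charK0 : [pchar K] =i pred0)
    (g : lieBialgType K)
    (d : nat) (V : finLieCoalgType K) (dimV : \dim {:V} = d)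
    (DD : lie_dual V -> BiDer g) (DD_morph : lie_morphism DD)
    (t : d.-tuple V) (t_basis : basis_of {:V} t) :
  let D (i : 'I_d) : g -> g := DD (dual_basis t i) in
  let L : lieAlgType K := (g * abelian_lie V)%type in
  let inG (x : g) : L := (x, 0) in
  let inV (v : V) : L := (0, v) in
  lie_bialgebra_structure (fun xv : L =>
    tmap inG inG (cobr xv.1)
    + 2 *: (\sum_(i < d) wedge (inG (D i xv.1)) (inV t`_i))
    + tmap inV inV (cobr (xv.2 : V))).
Proof.
move=> D L inG inV.
have nz2 : 2 != 0 :> K by have := charK0 2; rewrite !inE /= => ->.
(* Naming the inclusions as bundled linear maps keeps the product type folded. *)
have [iG iGE] : {iG : {linear g -> L} | inG = iG}.
  by apply: linear_ex => a x y; apply: injective_projections; rewrite /= ?scaler0 ?addr0.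
have [iV iVE] : {iV : {linear V -> L} | inV = iV}.
  by apply: linear_ex => a x y; apply: injective_projections; rewrite /= ?scaler0 ?addr0.
have decomp (l : L) : l = iG l.1 + iV l.2.
  by rewrite -iGE -iVE; apply: injective_projections; rewrite /= ?addr0 ?add0r.
set co0 := (X in lie_bialgebra_structure X).
have co0E l : co0 l = tmap iG iG (cobr l.1)
    + \sum_(i < d) skewr (iV t`_i) (iG (D i l.1)) + tmap iV iV (cobr (l.2 : V)).
  rewrite /co0 iGE iVE scaler_sumr; congr (_ + _ + _).
  by apply: eq_bigr => i _; apply: wedge_skewr.
have skco l : Lambda2 (co0 l).
  rewrite /co0 iGE iVE; apply: Lambda2D; last first.
    by apply: Lambda2_tmap; have [_ h _] := @cobrP K V; apply: h.
  apply: Lambda2D; last exact/Lambda2Z/Lambda2_sum.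
  by apply: Lambda2_tmap; have [_ h _] := @cobrP K g; apply: h.
have co0l : linear co0.
  move=> a l m; rewrite !co0E.
  have -> : (a *: l + m).1 = a *: l.1 + m.1 by [].
  have -> : (a *: l + m).2 = a *: (l.2 : V) + m.2 by [].
  have cobrP' (W : lieCoalgType K) (f : {linear W -> L}) b (x y : W) :
    tmap f f (cobr (b *: x + y)) = b *: tmap f f (cobr x) + tmap f f (cobr y).
    exact: (linearP (tmap f f \o cobr)).
  rewrite (cobrP' _ iG) (cobrP' _ iV).
  rewrite !scalerDr [RHS]addrACA; congr (_ + _).
  rewrite [RHS]addrACA; congr (_ + _).
  rewrite scaler_sumr -big_split; apply: eq_bigr => i _.
  exact: (linearP (skewr (iV t`_i) \o (iG \o DD (dual_basis t i)))).
have [co coE] := linear_ex co0l.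
have cobr0 (W : lieCoalgType K) : cobr (0 : W) = 0 by exact: linear0.
have coG x : co (iG x) = tmap iG iG (cobr x)
    + \sum_(i < d) skewr (iV t`_i) (iG (DD (dual_basis t i) x)).
  rewrite -coE co0E; have -> : (iG x).1 = x by rewrite -iGE.
  have -> : (iG x).2 = 0 by rewrite -iGE.
  by rewrite (cobr0 V) (linear0 (tmap iV iV)) addr0.
have coV v : co (iV v) = tmap iV iV (cobr v).
  rewrite -coE co0E; have -> : (iV v).1 = 0 by rewrite -iVE.
  have -> : (iV v).2 = v by rewrite -iVE.
  rewrite (cobr0 g) (linear0 (tmap iG iG)) add0r big1 ?add0r // => i _.
  have D0 : D i 0 = 0 by exact: (linear0 (DD (dual_basis t i))).
  by rewrite D0 (linear0 iG) (linear0 (skewr _)).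
split; first split=> // l.
  rewrite (decomp l) coE (linearD co) (linearD (tmap co idfun)) /=.
  rewrite (linearD (@Alt3 K L)) /=.
  by rewrite (Alt3_coG t_basis DD_morph coG coV) Alt3_coV // addr0.
(* The bracket with p acts on the image of g through p.1 and kills that of V. *)
move=> l m; rewrite coE.
have brG (p : L) x : lieb p (iG x) = iG (lieb p.1 x).
  by rewrite -iGE.
have brV (p : L) v : lieb p (iV v) = 0.
  rewrite -iVE; congr pair; exact: (linear0 (lieb p.1)).
have brco (p q : L) : leib (lieb p) (co q) = tmap iG iG (leib (lieb p.1) (cobr q.1))
    + \sum_(i < d) skewr (iV t`_i) (iG (lieb p.1 (D i q.1))).
  rewrite -coE co0E !(linearD (leib (lieb p))) /= (leib_tmap_eq0 _ (brV p)) addr0.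
  rewrite (leib_tmap _ (brG p)); congr (_ + _).
  rewrite (linear_sum (leib (lieb p))); apply: eq_bigr => i _ /=.
  by rewrite (leib_skewr _ (brV p _)) /= brG.
have -> : lieb l m = iG (lieb l.1 m.1) by rewrite -iGE.
rewrite coG !brco cobr_cocycle (linearB (tmap iG iG)) opprD addrACA /=.
congr (_ + _); rewrite -sumrB; apply: eq_bigr => i _.
(* The mixed terms agree because D i is a derivation. *)
have [[_ ->] _] := biderivationP (DD (dual_basis t i)).
by rewrite (liebN (D i l.1)) addrC (linearB iG) (linearB (skewr _)).
Qed.
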